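(* Let $a=(a_1,a_2,\dots)$ be an infinite sequence of positive integers and let $k\ge 2$ be an integer such that $\gcd(a_1,\dots,a_k)=1$. Put $d_i=\gcd(a_1,\dots,a_i)$ for $i\ge 1$ and define sequences $s^+_i,s^-_i$ ($i\geq 1$) by $$s^+_1=\frac{a_1a_2}{2d_2},\qquad s^+_{i+1}=s^+_i+\frac{d_i}{2d_{i+1}}\,a_{i+1},$$ $$s^-_1=-a_1,\qquad s^-_{i+1}=s^-_i+\left(\frac{d_i}{d_{i+1}}-1\right)a_{i+1}.$$ Then: (i) for every integer $n\ge 0$, $$D^a_k(n)\le \frac{(n+s^+_k)^{k-1}}{(k-1)!\prod_{i=1}^{k}a_i};$$ (ii) for every integer $n\ge 0$ with $n\ge s^-_k$, $$D^a_k(n)\ge \frac{(n-s^-_k)^{k-1}}{(k-1)!\prod_{i=1}^{k}a_i}.$$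
   Context: For an infinite sequence $a=(a_1,a_2,\dots)$ of positive integers, an integer $k\ge1$ and an integer $n\ge 0$, the denumerant $D^a_k(n)$ is the number of $k$-tuples $(x_1,\dots,x_k)$ of non-negative integers with $a_1x_1+\dots+a_kx_k=n$. *)

(* Defs.v *)
From mathcomp Require Import all_boot all_order all_algebra.

Set Implicit Arguments.
Unset Strict Implicit.
Unset Printing Implicit Defensive.

Import GRing.Theory.

(* A sequence (a_1, a_2, ...) is a function a : nat -> nat with a_i = a i for
   i >= 1; the value a 0 is never used. *)

(* An index i : 'I_k stands for the position i.+1. The coordinates of a
   solution are at most n as long as a_1, ..., a_k are positive, so it is
   enough to count in a finite type; see denumerantP. *)
Definition solutions (a : nat -> nat) (k n : nat) :
    {set {ffun 'I_k -> 'I_n.+1}} :=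
  [set x : {ffun 'I_k -> 'I_n.+1} | \sum_(i < k) a i.+1 * x i == n].

Definition denumerant (a : nat -> nat) (k n : nat) : nat :=
  #|solutions a k n|.

(* The unbounded solutions are exactly the members of a duplicate-free list
   of length denumerant a k n. *)
Lemma denumerantP (a : nat -> nat) (k n : nat) :
  (forall i, 1 <= i -> 0 < a i) ->
  exists s : seq {ffun 'I_k -> nat},
    [/\ uniq s, size s = denumerant a k n
      & forall x : {ffun 'I_k -> nat},
          (x \in s) = (\sum_(i < k) a i.+1 * x i == n)].
Proof.
move=> a_gt0.
pose f (x : {ffun 'I_k -> 'I_n.+1}) := [ffun i => x i : nat].
exists [seq f x | x in solutions a k n]; split.
- rewrite map_inj_uniq ?enum_uniq // => x y /ffunP fxy.
  by apply/ffunP => i; apply: val_inj; have := fxy i; rewrite !ffunE.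
- by rewrite size_map /denumerant cardE.
move=> x; apply/imageP/idP => [[y + ->]|/eqP sum_x].
  by rewrite inE; under [in X in _ -> X]eq_bigr do rewrite ffunE.
have x_lt i : x i < n.+1.
  rewrite ltnS -sum_x (bigD1 i) //=.
  by apply: leq_trans (leq_addr _ _); rewrite leq_pmull ?a_gt0.
exists [ffun i => Ordinal (x_lt i)].
  by rewrite inE; apply/eqP; rewrite -[RHS]sum_x; apply: eq_bigr => i _; rewrite ffunE.
by apply/ffunP => i; rewrite !ffunE.
Qed.

Definition gcd_upto (a : nat -> nat) (i : nat) : nat :=
  \big[gcdn/0]_(1 <= j < i.+1) a j.

Local Open Scope ring_scope.

(* The value at index 0 of the two sequences below is a dummy. *)
Fixpoint splus (a : nat -> nat) (i : nat) : rat :=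
  match i with
  | 0 => 0
  | 1 => (a 1%N * a 2%N)%:R / (2 * gcd_upto a 2)%:R
  | (_.+1 as j).+1 =>
      splus a j
        + (gcd_upto a j)%:R / (2 * gcd_upto a j.+1)%:R * (a j.+1)%:R
  end.

Fixpoint sminus (a : nat -> nat) (i : nat) : rat :=
  match i with
  | 0 => 0
  | 1 => - (a 1%N)%:R
  | (_.+1 as j).+1 =>
      sminus a j
        + ((gcd_upto a j)%:R / (gcd_upto a j.+1)%:R - 1) * (a j.+1)%:R
  end.

(* Main.v *)
(* Let G_i be the geometric series in X^(a_i), truncated after B > n terms, so
   that D_k(n) is the n-th coefficient of G_1 ... G_k. With q = d_k / d_{k+1}
   and c = q a_{k+1}, multiplying by 1 - X^c gives
     D_{k+1}(n) = D_k(n - a_{k+1} r) + D_{k+1}(n - c)   when d_{k+1} | n,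
   where r < q is the only index with d_k | n - a_{k+1} r. Both bounds, in the
   form with an extra factor d_k and for d_k | n, follow by induction on k, then
   on n. The sum over the multiples of c is compared with the integral of
   t^(k-1): by convexity at midpoints from above, by monotonicity from below.
   Near 0 the lower bound needs s^-_k >= - d_k and the divisibility of n. *)

Require Import Defs.
From mathcomp Require Import all_boot all_order all_algebra.
From mathcomp Require Import ring lra.

Import Order.TTheory GRing.Theory Num.Theory.
Local Open Scope ring_scope.

(** * Generating functions and the recurrence in [n] *)

(** The bound [B] is independent of [n], so that an induction can lower [n] with [B] fixed. *)
Definition bounded_denumerant (a : nat -> nat) (B k n : nat) : nat :=
  #|[set x : {ffun 'I_k -> 'I_B} | (\sum_(i < k) a i.+1 * x i)%N == n]|.

Lemma bounded_denumerant_coef (a : nat -> nat) (B k n : nat) :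
  (bounded_denumerant a B k n)%:R =
    (\prod_(i < k) \sum_(j < B) 'X^(a i.+1 * j))`_n :> rat.
Proof.
rewrite bigA_distr_bigA coef_sum /bounded_denumerant -sum1dep_card.
rewrite natr_sum [in LHS]big_mkcond; apply: eq_bigr => f _.
have -> : \prod_(i < k) 'X^(a i.+1 * f i) =
    'X^(\sum_(i < k) a i.+1 * f i) :> {poly rat}.
  by elim/big_rec2: _ => [|i m p _ ->]; rewrite ?expr0 // exprD.
by rewrite coefXn eq_sym; case: eqP.
Qed.

Lemma bounded_denumerant_rec (a : nat -> nat) (B k n q : nat) :
  (0 < a k.+1)%N -> (n < B)%N ->
  bounded_denumerant a B k.+1 n =
    (\sum_(i < q | a k.+1 * i <= n) bounded_denumerant a B k (n - a k.+1 * i)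
     + (if a k.+1 * q <= n then
          bounded_denumerant a B k.+1 (n - a k.+1 * q) else 0))%N.
Proof.
set b := a k.+1 => b_gt0 n_lt.
(* The identity is moved to [rat], where polynomials can be subtracted. *)
apply: (@mulrIn rat 1 (oner_neq0 _)).
set P := fun k : nat => \prod_(i < k) \sum_(j < B) 'X^(a i.+1 * j) : {poly rat}.
have geom m : (\sum_(j < m) 'X^(b * j)) * (1 - 'X^b) = 1 - 'X^(b * m) :> {poly rat}.
  rewrite mulrC -opprB mulNr exprM -[1 - _]opprB; congr (- _).
  by rewrite [RHS]subrX1; congr (_ * _); apply: eq_bigr => j _; rewrite exprM.
have PS : P k.+1 * (1 - 'X^(b * q)) =
    P k * (\sum_(i < q) 'X^(b * i)) * (1 - 'X^(b * B)).
  by rewrite /P big_ord_recr /= -/(P k) -(geom q) -(geom B) -/b; ring.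
have := congr1 (fun p : {poly rat} => p`_n) PS.
rewrite !mulrBr !mulr1 !coefB !coefMXn.
(* The truncation factor [1 - 'X^(b * B)] does not reach the coefficient at [n]. *)
have -> : (n < b * B)%N by apply: leq_trans n_lt _; rewrite leq_pmull.
rewrite subr0 mulr_sumr coef_sum => /(canRL (subrK _)) PSn.
rewrite natrD natr_sum bounded_denumerant_coef -/(P k.+1) PSn; congr (_ + _).
  rewrite [RHS]big_mkcond; apply: eq_bigr => i _; rewrite coefMXn ltnNge.
  by case: leqP => // _; rewrite bounded_denumerant_coef.
by rewrite ltnNge; case: leqP => // _; rewrite bounded_denumerant_coef.
Qed.

(** * Divisibility by the prefix gcds *)

Lemma gcd_uptoS (a : nat -> nat) (k : nat) :
  gcd_upto a k.+1 = gcdn (gcd_upto a k) (a k.+1).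
Proof. by rewrite /gcd_upto big_nat_recr. Qed.

Lemma gcd_upto1 (a : nat -> nat) : gcd_upto a 1 = a 1%N.
Proof. by rewrite /gcd_upto big_nat1. Qed.

Lemma gcd_upto_gt0 (a : nat -> nat) (k : nat) :
  (0 < a 1)%N -> (0 < gcd_upto a k.+1)%N.
Proof.
move=> a1_gt0; elim: k => [|k IHk]; first by rewrite gcd_upto1.
by rewrite gcd_uptoS gcdn_gt0 IHk.
Qed.

Lemma gcd_upto_dvd (a : nat -> nat) (k : nat) (i : 'I_k) :
  (gcd_upto a k %| a i.+1)%N.
Proof.
elim: k i => [[] //|k IHk i]; rewrite gcd_uptoS.
have [ik|] := ltnP i k; first exact: dvdn_trans (dvdn_gcdl _ _) (IHk (Ordinal ik)).
rewrite leq_eqVlt ltnNge -ltnS ltn_ord orbF => /eqP <-; exact: dvdn_gcdr.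
Qed.

Lemma bounded_denumerant_eq0 (a : nat -> nat) (B k n : nat) :
  ~~ (gcd_upto a k %| n)%N -> bounded_denumerant a B k n = 0%N.
Proof.
move=> ndvd; apply/eqP; rewrite cards_eq0; apply/eqP/setP => x.
rewrite !inE; apply: contraNF ndvd => /eqP <-.
by apply: dvdn_sum => i _; rewrite dvdn_mulr ?gcd_upto_dvd.
Qed.

(** After division by [gcdn d a], the factor [a] becomes invertible modulo [d %/ gcdn d a]. *)
Lemma exists_mul_eqmod (a d n : nat) :
  (0 < a)%N -> (0 < d)%N -> (gcdn d a %| n)%N ->
  exists2 r, (r < d %/ gcdn d a)%N &
    forall i, (i < d %/ gcdn d a)%N -> (a * i == n %[mod d]) = (i == r).
Proof.
move=> a_gt0 d_gt0 /dvdnP[w ->]; set g := gcdn d a; set q := (d %/ g)%N.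
have g_gt0 : (0 < g)%N by rewrite gcdn_gt0 d_gt0.
have dE : d = (q * g)%N by rewrite divnK ?dvdn_gcdl.
have aE : a = (a %/ g * g)%N by rewrite divnK ?dvdn_gcdr.
have q_gt0 : (0 < q)%N by rewrite divn_gt0 // dvdn_leq ?dvdn_gcdl.
have co : coprime q (a %/ g).
  by rewrite /coprime -(eqn_pmul2r g_gt0) muln_gcdl -dE -aE mul1n.
have d_aq : (d %| a * q)%N by rewrite {1}dE aE mulnAC -mulnA dvdn_mull.
case: (egcdnP d a_gt0) => u v uv _; rewrite gcdnC -/g in uv.
(* Bezout gives [u * a = v * d + g], so [u * w] solves the congruence; it may be reduced modulo [q]
   because [d] divides [a * q]. *)
pose r := ((u * w) %% q)%N.
have rP : (a * r == w * g %[mod d])%N.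
  rewrite muln_modr -(modn_dvdm _ d_aq) modn_mod modn_dvdm //.
  by rewrite mulnA (mulnC a) uv mulnDl mulnAC modnMDl (mulnC g).
exists r; first by rewrite ltn_mod.
move=> i i_lt; apply/idP/eqP => [iP|-> //].
have eq_dvd x y : (x < q)%N -> (x <= y)%N -> (y < q)%N ->
    (a * x == a * y %[mod d])%N -> x = y.
  move=> _ le_xy y_lt; rewrite eq_sym eqn_mod_dvd ?leq_mul2l ?le_xy ?orbT //.
  rewrite -mulnBr aE dE mulnAC dvdn_pmul2r // Gauss_dvdr // => /eqnP.
  rewrite modn_small ?(leq_ltn_trans (leq_subr _ _)) // => /eqP.
  by rewrite subn_eq0 => le_yx; apply/eqP; rewrite eqn_leq le_xy.
have r_lt : (r < q)%N by rewrite ltn_mod.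
have [le_ir|/ltnW le_ri] := leqP i r.
  by apply: eq_dvd => //; rewrite (eqP iP) (eqP rP).
by apply/esym/eq_dvd => //; rewrite (eqP iP) (eqP rP).
Qed.

Lemma bounded_denumerant_step (a : nat -> nat) (B k n : nat) :
  (0 < a k.+1)%N -> (0 < gcd_upto a k)%N -> (n < B)%N ->
  (gcd_upto a k.+1 %| n)%N ->
  let q := (gcd_upto a k %/ gcd_upto a k.+1)%N in
  exists r, [/\ (r < q)%N, a k.+1 * r = n %[mod gcd_upto a k]%N &
    bounded_denumerant a B k.+1 n =
      ((if a k.+1 * r <= n then bounded_denumerant a B k (n - a k.+1 * r) else 0)
       + (if a k.+1 * q <= n then
            bounded_denumerant a B k.+1 (n - a k.+1 * q) else 0))%N].
Proof.
move=> b_gt0 d_gt0 n_lt dvd_n q; move: (dvd_n); rewrite gcd_uptoS => dvd_n'.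
have [r r_lt rP] := exists_mul_eqmod _ _ _ b_gt0 d_gt0 dvd_n'.
rewrite -gcd_uptoS -/q in r_lt rP.
exists r; split=> //; first by apply/eqP; rewrite rP.
rewrite (bounded_denumerant_rec _ _ _ _ q) //; congr (_ + _)%N.
rewrite big_mkcond (bigD1 (Ordinal r_lt)) //=.
rewrite [X in (_ + X)%N]big1 ?addn0 // => i ne_ir.
case: leqP => // le_in; apply: bounded_denumerant_eq0.
by rewrite -eqn_mod_dvd // eq_sym rP.
Qed.

Lemma bounded_denumerant1 (a : nat -> nat) (B n : nat) :
  (0 < a 1)%N -> (n < B)%N ->
  bounded_denumerant a B 1 n = (a 1%N %| n)%N.
Proof.
move=> a1_gt0 n_lt; case: (boolP (_ %| _)%N) => [/dvdnP[m mE]|ndvd]; last first.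
  by rewrite bounded_denumerant_eq0 ?gcd_upto1.
have m_lt : (m < B)%N.
  by apply: leq_ltn_trans n_lt; rewrite mE leq_pmulr.
apply/eqP/cards1P; exists [ffun => Ordinal m_lt]; apply/setP => x.
rewrite !inE big_ord1 mE mulnC eqn_pmul2r //.
apply/eqP/eqP => [xE|->]; last by rewrite ffunE.
by apply/ffunP => i; rewrite ffunE (ord1 i); apply: val_inj.
Qed.

(** * Power inequalities in place of integrals *)

(* The first bound is only there to make the induction go through. *)
Lemma pow_midpoint (R : realDomainType) (y h : R) (k : nat) :
  0 <= h -> h <= y ->
  2 * y ^+ k.+1 <= (y + h) ^+ k.+1 + (y - h) ^+ k.+1 /\
  k.+1%:R * (2 * h) * y ^+ k <= (y + h) ^+ k.+1 - (y - h) ^+ k.+1.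
Proof.
move=> h_ge0 le_hy; have y_ge0 : 0 <= y by apply: le_trans le_hy.
elim: k => [|k [IHs IHd]]; first by rewrite expr0 !expr1; split; lra.
rewrite ![_ ^+ k.+2]exprS.
(* If [S] and [D] are the sum and difference at one exponent, the next ones are [y * S + h * D] and
   [y * D + h * S]. *)
have := ler_wpM2l y_ge0 IHs; have := ler_wpM2l y_ge0 IHd.
have := ler_wpM2l h_ge0 IHs; have := ler_wpM2l h_ge0 IHd.
have : 0 <= h * (k.+1%:R * (2 * h) * y ^+ k).
  by rewrite !mulr_ge0 ?exprn_ge0 ?ler0n.
rewrite -[k.+2]addn1 natrD !exprS.
set u := (y + h) ^+ k; set v := (y - h) ^+ k; set w := y ^+ k; set m := k.+1%:R.
by move=> *; split; lra.
Qed.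

(** The case [k = 0] is [0 <= (y - h) ^+ 2]; multiplying by [y + h] raises the exponent, thanks to
    [y <= h]. *)
Lemma pow_upper_small (R : realDomainType) (y h : R) (k : nat) :
  0 <= y -> y <= h -> k.+2%:R * (2 * h) * y ^+ k.+1 <= (y + h) ^+ k.+2.
Proof.
move=> y_ge0 le_yh; have h_ge0 : 0 <= h by apply: le_trans le_yh.
elim: k => [|k IHk]; first by rewrite expr1; have := sqr_ge0 (y - h); lra.
rewrite [in X in _ <= X]exprS.
apply: le_trans (ler_wpM2l (addr_ge0 y_ge0 h_ge0) IHk).
have w_ge0 : 0 <= h * y ^+ k.+1 by rewrite mulr_ge0 ?exprn_ge0.
have kh : y <= k.+2%:R * h.
  by apply: le_trans le_yh _; rewrite ler_peMl // ler1n.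
have := ler_wpM2l w_ge0 kh.
rewrite -[k.+3]addn1 natrD [y ^+ k.+2]exprS.
by set w := y ^+ _; set m := k.+2%:R; lra.
Qed.

(* [pow_midpoint] without its negative term, hence with no need of [h <= y]. *)
Lemma pow_upper (R : realDomainType) (y h : R) (k : nat) :
  0 <= h -> 0 <= y -> k.+2%:R * (2 * h) * y ^+ k.+1 <= (y + h) ^+ k.+2.
Proof.
move=> h_ge0 y_ge0; have [le_yh|/ltW le_hy] := leP y h.
  exact: pow_upper_small.
have [_] := pow_midpoint R y h k.+1 h_ge0 le_hy.
move=> /le_trans; apply; rewrite gerBl exprn_ge0 //; lra.
Qed.

(** The left side is the integral of [(k + 1) t^k] over [[y - c, y]], where [t^k] is largest at
    [y]. *)
Lemma pow_lower (R : realDomainType) (y c : R) (k : nat) :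
  0 <= c -> c <= y -> y ^+ k.+1 - (y - c) ^+ k.+1 <= k.+1%:R * c * y ^+ k.
Proof.
move=> c_ge0 le_cy; have y_ge0 : 0 <= y by apply: le_trans le_cy.
elim: k => [|k IHk]; first by rewrite expr0 !expr1; lra.
have le_z : (y - c) ^+ k.+1 <= y ^+ k.+1 by rewrite lerXn2r ?nnegrE //; lra.
have := ler_wpM2l y_ge0 IHk; have := ler_wpM2l c_ge0 le_z.
rewrite -[k.+2]addn1 natrD ![_ ^+ (k.+1 + 1)]exprD !expr1.
rewrite [y ^+ k.+1]exprS.
set u := (y - c) ^+ _; set w := y ^+ k; set m := k.+1%:R.
by lra.
Qed.

(** * The two bounds by induction *)

Lemma splus_ge0 (a : nat -> nat) (k : nat) : 0 <= splus a k.
Proof.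
elim: k => [//|[_|k IHk]]; first by rewrite divr_ge0 ?ler0n.
by rewrite addr_ge0 // !mulr_ge0 ?invr_ge0 ?ler0n.
Qed.

Section Bounds.

Variables (a : nat -> nat) (B : nat).
Hypothesis a_gt0 : forall i, (1 <= i)%N -> (0 < a i)%N.

Local Notation C := (bounded_denumerant a B).
Local Notation d := (gcd_upto a).
Local Notation P k := (\prod_(1 <= i < k.+1) a i)%N.

Let d_gt0 k : (0 < d k.+1)%N.
Proof. exact/gcd_upto_gt0/a_gt0. Qed.

Let q k := (d k.+1 %/ d k.+2)%N.

Let dE k : d k.+1 = (q k * d k.+2)%N.
Proof. by rewrite /q divnK // gcd_uptoS dvdn_gcdl. Qed.

Let q_gt0 k : (0 < q k)%N.
Proof. by have := d_gt0 k; rewrite dE muln_gt0 => /andP[]. Qed.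

Let d_neq0 k : (d k.+1)%:R != 0 :> rat.
Proof. by rewrite pnatr_eq0 -lt0n. Qed.

Let ratioE k : (d k.+1)%:R / (d k.+2)%:R = (q k)%:R :> rat.
Proof. by rewrite dE natrM mulfK. Qed.

Let splusS k : splus a k.+2 = splus a k.+1 + (q k * a k.+2)%:R / 2.
Proof. rewrite [LHS]/= -/(splus a k.+1) !natrM -ratioE; field; exact: d_neq0. Qed.

Let sminusS k : sminus a k.+2 = sminus a k.+1 + (q k * a k.+2)%:R - (a k.+2)%:R.
Proof. by rewrite [LHS]/= -/(sminus a k.+1) ratioE natrM; ring. Qed.


Let PS k : (P k.+2 = P k.+1 * a k.+2)%N.
Proof. by rewrite big_nat_recr. Qed.

Let step k n : (n < B)%N -> (d k.+2 %| n)%N ->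
  exists r, [/\ (r < q k)%N, (a k.+2 * r = n %[mod d k.+1])%N &
    C k.+2 n =
      ((if a k.+2 * r <= n then C k.+1 (n - a k.+2 * r) else 0)
       + (if q k * a k.+2 <= n then C k.+2 (n - q k * a k.+2) else 0))%N].
Proof.
move=> n_lt dvd_n; rewrite (mulnC (q k)).
by apply: bounded_denumerant_step; rewrite ?a_gt0.
Qed.

(* The midpoint argument needs an exponent at least 1, so [k = 2] is done apart. *)
Lemma bounded_denumerant_upper2 (n : nat) : (n < B)%N ->
  (C 2 n * P 2)%:R <= (d 2)%:R * (n%:R + splus a 2) :> rat.
Proof.
have qdE : ((q 0 * a 2) * d 2 = P 2)%N.
  by rewrite PS big_nat1 -[a 1%N]gcd_upto1 (dE 0) mulnAC.
have splus2 : splus a 2 = (q 0 * a 2)%:R.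
  rewrite splusS /= !natrM -[a 1%N]gcd_upto1 -ratioE; field; exact: d_neq0.
elim/ltn_ind: n => n IHn n_lt.
have [dvd_n|/bounded_denumerant_eq0->] := boolP (d 2 %| n)%N; last first.
  by rewrite mul0n mulr_ge0 ?ler0n // addr_ge0 ?splus_ge0 ?ler0n.
rewrite splus2 -natrD -natrM ler_nat.
have [r [_ _ ->]] := step 0 n n_lt dvd_n.
set X := (if (_ <= _)%N then _ else _); set Y := (if _ then _ else _).
have leX : (X <= 1)%N.
  rewrite /X; case: (_ * r <= n)%N => //.
  rewrite bounded_denumerant1 ?a_gt0 ?leq_b1 //.
  exact: leq_ltn_trans (leq_subr _ _) n_lt.
have leY : (Y * P 2 <= d 2 * n)%N.
  rewrite /Y; case: (leqP (q 0 * a 2) n) => [le_cn|_]; last by rewrite mul0n.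
  have qa_gt0 : (0 < q 0 * a 2)%N by rewrite muln_gt0 q_gt0 a_gt0.
  have lt_n : (n - q 0 * a 2 < n)%N by rewrite ltn_subrL qa_gt0 (leq_trans qa_gt0).
  have := IHn _ lt_n (ltn_trans lt_n n_lt).
  by rewrite splus2 -natrD subnK // -natrM ler_nat.
(* Since [d 2 * (q 0 * a 2) = P 2], the shift [splus a 2] pays for the at most one solution counted
   by [X]. *)
rewrite mulnDl mulnDr addnC leq_add // mulnC.
by rewrite (mulnC (d 2)) qdE -[leqRHS]muln1 leq_mul2l leX orbT.
Qed.

Lemma bounded_denumerant_upper (k n : nat) : (n < B)%N ->
  (C k.+2 n * (k.+1`! * P k.+2))%:R <=
    (d k.+2)%:R * (n%:R + splus a k.+2) ^+ k.+1 :> rat.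
Proof.
elim: k n => [|k IHk] n.
  by rewrite mul1n expr1; apply: bounded_denumerant_upper2.
elim/ltn_ind: n => n IHn n_lt.
have s_ge0 := splus_ge0 a k.+2.
have [dvd_n|/bounded_denumerant_eq0->] := boolP (d k.+3 %| n)%N; last first.
  by rewrite mul0n mulr_ge0 ?ler0n // exprn_ge0 // addr_ge0 ?splus_ge0 ?ler0n.
have [r [_ _ ->]] := step k.+1 n n_lt dvd_n.
set X := (if (a _ * r <= n)%N then _ else _); set Y := (if _ then _ else _).
(* As [splus] grows by [h], the base of the power is [y + h] at [n] and [y - h] at [n - 2 * h]. *)
pose y := n%:R + splus a k.+2 : rat; pose h := (q k.+1 * a k.+3)%:R / 2 : rat.
have y_ge0 : 0 <= y by rewrite addr_ge0 ?ler0n.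
have h_ge0 : 0 <= h by rewrite divr_ge0 ?ler0n.
have leX : (X * (k.+1`! * P k.+2))%:R <= (d k.+2)%:R * y ^+ k.+1 :> rat.
  rewrite /X; case: (_ * r <= n)%N; last by rewrite mul0n mulr_ge0 ?exprn_ge0 ?ler0n.
  apply: le_trans (IHk _ (leq_ltn_trans (leq_subr _ _) n_lt)) _.
  rewrite ler_wpM2l ?ler0n // lerXn2r ?nnegrE //.
    by rewrite addr_ge0 ?ler0n.
  by rewrite lerD2r ler_nat leq_subr.
have yh : n%:R + splus a k.+3 = y + h by rewrite splusS addrA.
have leXY : k.+2%:R * (2 * h) * y ^+ k.+1 * (d k.+3)%:R
    + (Y * (k.+2`! * P k.+3))%:R <= (d k.+3)%:R * (y + h) ^+ k.+2.
  (* For [n < 2 * h] the term [Y] is 0 and [h <= y] may fail, whence [pow_upper]; otherwise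
     [pow_midpoint] telescopes. *)
  rewrite /Y; case: (leqP (q k.+1 * a k.+3) n) => [le_cn|_]; last first.
    by rewrite mul0n addr0 mulrC ler_wpM2l ?ler0n // pow_upper.
  have qa_gt0 : (0 < q k.+1 * a k.+3)%N by rewrite muln_gt0 q_gt0 a_gt0.
  have lt_n : (n - q k.+1 * a k.+3 < n)%N.
    by rewrite ltn_subrL qa_gt0 (leq_trans qa_gt0).
  have := IHn _ lt_n (ltn_trans lt_n n_lt).
  rewrite natrB // splusS -/h.
  have -> : n%:R - (q k.+1 * a k.+3)%:R + (splus a k.+2 + h) = y - h.
    by rewrite /y /h; field.
  have le_hy : h <= y.
    have : (q k.+1 * a k.+3)%:R <= n%:R :> rat by rewrite ler_nat.
    rewrite /y /h; have : 0 <= (q k.+1 * a k.+3)%:R :> rat by rewrite ler0n.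
    by set c := _%:R; lra.
  have [_ mid] := pow_midpoint _ y h k.+1 h_ge0 le_hy.
  have := ler_wpM2l (ler0n rat (d k.+3)) mid.
  by lra.
rewrite yh; apply: le_trans leXY; rewrite mulnDl natrD lerD2r.
(* The bound on [X] matches because [2 * h * d k.+3 = a k.+3 * d k.+2]. *)
have := ler_wpM2l (ler0n rat (k.+2 * a k.+3)) leX.
rewrite (dE k.+1) (factS k.+1) (PS k.+1) /h !natrM.
by set w := y ^+ _; lra.
Qed.

(** Each increment [(q k - 1) * a k.+2] is at least [(q k - 1) * d k.+2 = d k.+1 - d k.+2]. *)
Lemma sminus_ge_gcd (k : nat) : - (d k.+1)%:R <= sminus a k.+1.
Proof.
elim: k => [|k IHk]; first by rewrite gcd_upto1.
have d_le : (d k.+2)%:R <= (a k.+2)%:R :> rat.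
  by rewrite ler_nat dvdn_leq ?a_gt0 // gcd_uptoS dvdn_gcdr.
have q_ge1 : 1 <= (q k)%:R :> rat by rewrite ler1n.
rewrite dE natrM in IHk; rewrite sminusS natrM.
have : 0 <= ((q k)%:R - 1) * ((a k.+2)%:R - (d k.+2)%:R) :> rat.
  by rewrite mulr_ge0 // subr_ge0.
set u := (q k)%:R in IHk *; set v := (a _)%:R; set w := (d _)%:R in IHk *.
by lra.
Qed.

Lemma bounded_denumerant_lower (k n : nat) :
  (n < B)%N -> (d k.+1 %| n)%N -> sminus a k.+1 <= n%:R ->
  (d k.+1)%:R * (n%:R - sminus a k.+1) ^+ k <= (C k.+1 n * (k`! * P k.+1))%:R :> rat.
Proof.
elim: k n => [|k IHk].
  move=> n n_lt; rewrite gcd_upto1 => dvd_n _.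
  by rewrite bounded_denumerant1 ?a_gt0 // dvd_n expr0 mulr1 big_nat1 !mul1n.
elim/ltn_ind => n IHn n_lt dvd_n le_sn.
have [r [r_lt rP ->]] := step k n n_lt dvd_n.
set X := (if (a _ * r <= n)%N then _ else _); set Y := (if _ then _ else _).
pose y := n%:R - sminus a k.+2 : rat.
pose c := (q k * a k.+2)%:R : rat.
have y_ge0 : 0 <= y by rewrite subr_ge0.
have c_ge0 : 0 <= c by rewrite ler0n.
(* As [r <= q k - 1], subtracting [a k.+2 * r] from [n] costs at most the increment of [sminus]. *)
have ar_le : (a k.+2 * r)%:R <= c - (a k.+2)%:R.
  by rewrite lerBrDr -natrD ler_nat addnC -mulnS mulnC leq_mul2r r_lt orbT.
have le_y : y <= (n%:R - (a k.+2 * r)%:R) - sminus a k.+1.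
  by rewrite /y sminusS -/c; lra.
(* For [k = 0] and [y = 0] the inequality can fail, since [y ^+ 0 = 1]; the goal is then trivial,
   its power being [y ^+ k.+1 = 0]. *)
have geX : (d k.+1)%:R * y ^+ k <= (X * (k`! * P k.+1))%:R :> rat \/ y = 0.
  rewrite /X; case: (leqP (a k.+2 * r) n) => [le_n|lt_n].
    left; apply: le_trans (IHk _ (leq_ltn_trans (leq_subr _ _) n_lt) _ _).
    - by rewrite natrB // ler_wpM2l ?ler0n // lerXn2r ?nnegrE //; lra.
    - by rewrite -eqn_mod_dvd // rP.
    - by rewrite natrB //; lra.
  (* [a * r - n] is a positive multiple of [d k.+1], which forces [n = sminus]. *)
  right; have := sminus_ge_gcd k; have : (n + d k.+1 <= a k.+2 * r)%N.
    rewrite -leq_subRL ?(ltnW lt_n) // dvdn_leq ?subn_gt0 //.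
    by rewrite -eqn_mod_dvd ?rP // ltnW.
  rewrite -(ler_nat rat) natrD.
  by move: le_y; rewrite /y; lra.
have d'_ge0 : 0 <= (d k.+2)%:R :> rat by rewrite ler0n.
have geXY : (d k.+2)%:R * y ^+ k.+1 <=
    (d k.+2)%:R * (k.+1%:R * c * y ^+ k) + (Y * (k.+1`! * P k.+2))%:R.
  (* For [y <= c], the estimate [y ^+ k.+1 <= c * y ^+ k] suffices without any help from [Y]. *)
  have small : y <= c -> (d k.+2)%:R * y ^+ k.+1 <=
      (d k.+2)%:R * (k.+1%:R * c * y ^+ k) + (Y * (k.+1`! * P k.+2))%:R.
    move=> le_yc; rewrite ler_wpDr ?ler0n // ler_wpM2l //.
    rewrite exprS ler_wpM2r ?exprn_ge0 //.
    by apply: le_trans le_yc _; rewrite ler_peMl // ler1n.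
  have [/small //|/ltW le_cy] := leP y c.
  have dvd_c : (d k.+2 %| q k * a k.+2)%N.
    by rewrite dvdn_mull // gcd_uptoS dvdn_gcdr.
  move: small; rewrite /Y.
  case: (leqP (q k * a k.+2) n) => [le_cn _|lt_nc]; last first.
    (* [n < c] gives [n <= c - d k.+2], both being multiples of [d k.+2]. *)
    apply; have := sminus_ge_gcd k.+1.
    have : (n + d k.+2 <= q k * a k.+2)%N.
      by rewrite -leq_subRL ?(ltnW lt_nc) // dvdn_leq ?subn_gt0 // dvdn_sub.
    by rewrite -(ler_nat rat) natrD /y -/c; lra.
  have qa_gt0 : (0 < q k * a k.+2)%N by rewrite muln_gt0 q_gt0 a_gt0.
  have lt_n : (n - q k * a k.+2 < n)%N.
    by rewrite ltn_subrL qa_gt0 (leq_trans qa_gt0).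
  have := IHn _ lt_n (ltn_trans lt_n n_lt) (dvdn_sub dvd_n dvd_c).
  rewrite natrB // -/c.
  have -> : n%:R - c - sminus a k.+2 = y - c by rewrite /y; ring.
  have := ler_wpM2l d'_ge0 (pow_lower _ y c k c_ge0 le_cy).
  have le_s : sminus a k.+2 <= n%:R - c by move: le_cy; rewrite /y; lra.
  by move=> low /(_ le_s); lra.
case: geX => [geX|y0]; last by rewrite -/y y0 expr0n mulr0 ler0n.
apply: le_trans geXY _; rewrite mulnDl natrD lerD2r.
have := ler_wpM2l (ler0n rat (k.+1 * a k.+2)) geX.
rewrite (dE k) (factS k) (PS k) /c !natrM.
by set w := y ^+ _; lra.
Qed.

End Bounds.

Theorem lemma4p1 (a : nat -> nat) (k : nat)
    (a_gt0 : forall i : nat, (1 <= i)%N -> (0 < a i)%N)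
    (k_ge2 : (2 <= k)%N)
    (gcd_a : gcd_upto a k = 1%N) :
  (forall n : nat,
     (denumerant a k n)%:R <=
       (n%:R + splus a k) ^+ (k - 1)
         / ((k - 1)`! * \prod_(1 <= i < k.+1) a i)%:R :> rat) /\
  (forall n : nat, sminus a k <= n%:R ->
     (n%:R - sminus a k) ^+ (k - 1)
         / ((k - 1)`! * \prod_(1 <= i < k.+1) a i)%:R
       <= (denumerant a k n)%:R :> rat).
Proof.
case: k => [|[|k]] // in k_ge2 gcd_a *; rewrite subSS subn0.
have den_gt0 : 0 < (k.+1`! * \prod_(1 <= i < k.+3) a i)%:R :> rat.
  rewrite ltr0n muln_gt0 fact_gt0 big_nat_cond prodn_cond_gt0 // => i.
  by rewrite andbT => /andP[i_gt0 _]; apply: a_gt0.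
split=> n => [|le_sn].
  rewrite ler_pdivlMr // -natrM.
  (* With [B = n.+1] the count is convertible to [denumerant], and the extra gcd factor is 1. *)
  have := bounded_denumerant_upper a n.+1 a_gt0 k n (ltnSn n).
  by rewrite gcd_a mul1r.
rewrite ler_pdivrMr // -natrM.
have := bounded_denumerant_lower a n.+1 a_gt0 k.+1 n (ltnSn n).
by rewrite gcd_a dvd1n mul1r; apply.
Qed.
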